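(* There is an absolute constant $C_0>0$ such that for every $c\geq500$, with $w_q=1-\frac{10}{\sqrt c}$, $w_u=\frac{1}{\sqrt c}$, $\alpha=1-\frac{20}{\sqrt c}$, we have \[ \inf_{\substack{t_q,t_u\in[0,1]\\ t_u\neq w_u}}\left(\alpha\,\frac{D(T\|P)-D(t_q\|w_q)}{D(t_u\|w_u)}+(1-\alpha)\,\frac{D(T\|P)-D(t_u\|w_u)}{D(t_u\|w_u)}\right)\;\geq\;\alpha\Big(1-\frac{C_0}{\sqrt c}\Big), \] where $P=\begin{bmatrix} w_u & w_q-w_u\\ 0 & 1-w_q\end{bmatrix}$ and $T$ is the minimizer of $D(T\|P)$ over distributions $T$ absolutely continuous with respect to $P$ with $\mathbb{E}_{X\sim\mathrm{Bernoulli}(T)}[X]=\begin{bmatrix}t_q\\ t_u\end{bmatrix}$.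
   Context: KL divergence: $D(P\|Q)=\sum_\omega P(\omega)\log\frac{P(\omega)}{Q(\omega)}$ and for Bernoulli parameters $D(p\|q)=p\log\frac pq+(1-p)\log\frac{1-p}{1-q}$. For a $2\times2$ matrix $P=(P_{i,j})_{i,j\in\{0,1\}}$ of nonnegative entries summing to 1, $X\sim\mathrm{Bernoulli}(P)$ is the random vector in $\{0,1\}^2$ with $\Pr[X=(1-i,1-j)^\top]=P_{i,j}$. The paper writes the right side as $\alpha(1-\Theta(1)/\sqrt c)$. *)

(* Defs.v *)
From mathcomp Require Import all_boot all_order all_algebra.
From mathcomp Require Import all_classical all_reals all_analysis.
Set Implicit Arguments.
Unset Strict Implicit.
Unset Printing Implicit Defensive.
Import Order.TTheory GRing.Theory Num.Theory.
Local Open Scope classical_set_scope.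
Local Open Scope ring_scope.

Section Defs.
Variable R : realType.

(* Real-valued, hence meaningful only when P is absolutely continuous with
   respect to Q (the divergence is +oo otherwise).  Terms with P w = 0
   contribute 0, which is the convention 0 log (0 / q) = 0. *)
Definition kl (I : finType) (P Q : I -> R) : R :=
  \sum_(w : I) P w * ln (P w / Q w).

(* Meaningful for 0 < q < 1, and then finite for every p in [0, 1]. *)
Definition kl_bern (p q : R) : R :=
  p * ln (p / q) + (1 - p) * ln ((1 - p) / (1 - q)).

Definition mx2 (a b c d : R) : 'M[R]_2 :=
  \matrix_(i, j) if i == 0 then (if j == 0 then a else b)
                 else (if j == 0 then c else d).

Definition kl_mx (T P : 'M[R]_2) : R :=
  kl (fun w : 'I_2 * 'I_2 => T w.1 w.2) (fun w => P w.1 w.2).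

Definition is_distr (P : 'M[R]_2) : Prop :=
  (forall i j, 0 <= P i j) /\ \sum_i \sum_j P i j = 1.

Definition abs_cont (T P : 'M[R]_2) : Prop :=
  forall i j, P i j = 0 -> T i j = 0.

(* The law of X ~ Bernoulli(P): Pr[X = (1 - i, 1 - j)^T] = P i j, the map
   i |-> 1 - i on {0, 1} being rev_ord on 'I_2. *)
Definition bern_pmf (P : 'M[R]_2) (x : 'I_2 * 'I_2) : R :=
  P (rev_ord x.1) (rev_ord x.2).

Definition col2 (a b : R) : 'cV[R]_2 := \col_k if k == 0 then a else b.

Definition bern_mean (P : 'M[R]_2) : 'cV[R]_2 :=
  \sum_(x : 'I_2 * 'I_2)
     bern_pmf P x *: col2 (x.1 : nat)%:R (x.2 : nat)%:R.

Definition feasible (P : 'M[R]_2) (tq tu : R) (T : 'M[R]_2) : Prop :=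
  [/\ is_distr T, abs_cont T P & bern_mean T = col2 tq tu].

Definition is_minimizer (P : 'M[R]_2) (tq tu : R) (T : 'M[R]_2) : Prop :=
  feasible P tq tu T /\
  forall T', feasible P tq tu T' -> kl_mx T P <= kl_mx T' P.

Definition objective (P : 'M[R]_2) (wq wu alpha tq tu : R) (T : 'M[R]_2) : R :=
  alpha * ((kl_mx T P - kl_bern tq wq) / kl_bern tu wu)
  + (1 - alpha) * ((kl_mx T P - kl_bern tu wu) / kl_bern tu wu).

(* Pairs (tq, tu) without any feasible T contribute no value, i.e. they count
   as +oo in the infimum. *)
Definition objective_values (P : 'M[R]_2) (wq wu alpha : R) : set (\bar R) :=
  [set v | exists tq tu : R, exists T : 'M[R]_2,
     [/\ 0 <= tq <= 1, 0 <= tu <= 1, tu <> wu, is_minimizer P tq tu T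
       & v = (objective P wq wu alpha tq tu T)%:E]].

End Defs.

(* Main.v *)
Require Import Defs.
From mathcomp Require Import all_boot all_order all_algebra.
From mathcomp Require Import all_classical all_reals all_analysis.
From mathcomp Require Import ring lra.
Import Order.TTheory GRing.Theory Num.Theory.
Local Open Scope classical_set_scope.
Local Open Scope ring_scope.

(** Write [s = 1 / sqrt c], [x = tu], [y = 1 - tq].  The support of [P] forces
    [T] to have entries [x], [1 - x - y], [0], [y], so the claim is
    [D - Du - Dq + 20 s Dq + alpha C0 s Du >= 0], where [D], [Dq], [Du] are the
    three divergences.  Tangent-line bounds on the logarithm give
    [D - Du - Dq >= (x - s) (y - 10 s) / ((1 - s) (1 - 10 s))],
    and the Hellinger bound [a ln (a / b) >= a - b + (sqrt a - sqrt b)^2] makes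
    [Dq] and [Du] large enough to absorb this product when it is negative. *)

(** * Logarithm inequalities and lower bounds on divergences *)

Section LogBounds.
Variable R : realType.
Implicit Types a b r x : R.

Lemma ln_le_subr1 x : 0 < x -> ln x <= x - 1.
Proof. by move=> x0; rewrite -{1}(subrKC 1 x) le_ln1Dx //; lra. Qed.

Lemma mulr_ln_div_ge a b : 0 <= a -> 0 < b -> a - b <= a * ln (a / b).
Proof.
rewrite le_eqVlt => /predU1P[<- b0|a0 b0]; first by rewrite mul0r; lra.
have ba0 : 0 < b / a by rewrite divr_gt0.
have : a * ln (b / a) <= a * (b / a - 1) by rewrite ler_pM2l ?ln_le_subr1.
rewrite !ln_div ?posrE // !mulrBr mulr1 [a * (b / a)]mulrC divfK ?gt_eqF //.
by lra.
Qed.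

(** Convexity: the left side is the tangent at [r] to [a ln (a / b)] as a function of [a]. *)
Lemma mulr_ln_div_tangent a b r : 0 <= a -> 0 < b -> 0 < r ->
  a * ln (r / b) + a - r <= a * ln (a / b).
Proof.
move=> a0 b0 r0; have := mulr_ln_div_ge a r a0 r0.
move: a0; rewrite le_eqVlt => /predU1P[<-|a0]; first by rewrite !mul0r; lra.
by rewrite !ln_div ?posrE //; lra.
Qed.

(** Passing to [u = sqrt a], [v = sqrt b] doubles the logarithm; its linear bound then gives
    [a - b + (u - v)^2], and [(u + v)^2 <= 2 (a + b)] finishes. *)
Lemma mulr_ln_div_hellinger a b : 0 <= a -> 0 < b ->
  a - b + (a - b) ^+ 2 / (2 * (a + b)) <= a * ln (a / b).
Proof.
move=> a0 b0; have ab0 : 0 < a + b by lra.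
set u := Num.sqrt a; set v := Num.sqrt b.
have u0 : 0 <= u by exact: sqrtr_ge0.
have v0 : 0 < v by rewrite sqrtr_gt0.
have uE : a = u ^+ 2 by rewrite sqr_sqrtr.
have vE : b = v ^+ 2 by rewrite sqr_sqrtr// ltW.
have lnE : a * ln (a / b) = 2 * u * (u * ln (u / v)).
  move: u0; rewrite le_eqVlt => /predU1P[u0|u0].
    by rewrite uE -u0; ring.
  by rewrite uE vE -expr_div_n lnXn ?divr_gt0 //; ring.
have : 2 * u * (u - v) <= a * ln (a / b).
  by rewrite lnE ler_wpM2l ?mulr_ge0 // mulr_ln_div_ge.
apply: le_trans.
suff : (a - b) ^+ 2 / (2 * (a + b)) <= (u - v) ^+ 2 by rewrite uE vE; lra.
rewrite ler_pdivrMr ?mulr_gt0 // uE vE.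
rewrite (_ : (u ^+ 2 - v ^+ 2) ^+ 2 = (u - v) ^+ 2 * (u + v) ^+ 2);
  last by ring.
by rewrite ler_wpM2l ?sqr_ge0 //; have := sqr_ge0 (u - v); lra.
Qed.

(** The linear terms [a - b] and [b - a] of the two summands cancel, leaving the quadratic term of
    the first. *)
Lemma kl_bern_hellinger a b : 0 <= a <= 1 -> 0 < b < 1 ->
  (a - b) ^+ 2 / (2 * (a + b)) <= kl_bern a b.
Proof.
move=> /andP[a0 a1] /andP[b0 b1]; rewrite /kl_bern.
have := mulr_ln_div_hellinger a b a0 b0.
by have := mulr_ln_div_ge (1 - a) (1 - b); lra.
Qed.

Lemma kl_bernC a b : kl_bern (1 - a) (1 - b) = kl_bern a b.
Proof. by rewrite /kl_bern !subKr addrC. Qed.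

(* Here [u = 1 - x] and [v = 1 - y].  The tangent to the first term is taken at
   [r = u v (u0 + v0 - 1) / (u0 v0)], so that [ln (r / (u0 + v0 - 1))] splits
   into [ln (u / u0) + ln (v / v0)]. *)
Lemma interaction_ge (u v u0 v0 : R) :
  0 <= u <= 1 -> 0 <= v <= 1 -> 0 <= u + v - 1 ->
  0 < u0 -> 0 < v0 -> 0 < u0 + v0 - 1 ->
  (u0 - u) * (v0 - v) / (u0 * v0) <=
  (u + v - 1) * ln ((u + v - 1) / (u0 + v0 - 1))
    - u * ln (u / u0) - v * ln (v / v0).
Proof.
move=> /andP[uge0 u1] /andP[vge0 v1] m_ge0 u0_gt0 v0_gt0 m0_gt0.
have u0n : u0 != 0 by rewrite gt_eqF.
have v0n : v0 != 0 by rewrite gt_eqF.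
have mul_ln_le (x w z : R) : 0 <= x -> 0 < w -> 0 < z ->
    x * ln (w / z) <= x * (w / z - 1).
  by move=> x0 w0 z0; rewrite ler_wpM2l // ln_le_subr1 // divr_gt0.
have diag_ln_le (w z : R) : 0 <= w -> 0 < z ->
    w * ln (w / z) <= w * (w / z - 1).
  move=> w_ge0 z0; case: (eqVneq w 0) => [->|wn]; first by rewrite !mul0r.
  by apply: mul_ln_le; rewrite // lt_def wn.
(* At [u + v = 1] the tangent point [r] may be 0. There the first term vanishes, and the linear
   bounds exceed the claim by [u v (u0 + v0 - 1) / (u0 v0)]. *)
move: m_ge0; rewrite le_eqVlt => /predU1P[m_eq0|m_gt0].
  rewrite -m_eq0 mul0r.
  have uE : u = 1 - v by lra.
  have hu := diag_ln_le u u0 uge0 u0_gt0.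
  have hv := diag_ln_le v v0 vge0 v0_gt0.
  have h : 0 <= u * v * ((u0 + v0 - 1) / (u0 * v0)).
    apply: mulr_ge0; first exact: mulr_ge0.
    by rewrite divr_ge0 ?(ltW m0_gt0) // mulr_ge0 // ltW.
  suff : (u0 - u) * (v0 - v) / (u0 * v0) + u * v * ((u0 + v0 - 1) / (u0 * v0))
     = - (u * (u / u0 - 1)) - v * (v / v0 - 1) by lra.
  by rewrite uE; field; rewrite u0n v0n.
have u_gt0 : 0 < u by lra.
have v_gt0 : 0 < v by lra.
set m0 := u0 + v0 - 1 in m0_gt0 *.
set r := u * v * (m0 / (u0 * v0)).
have r0 : 0 < r by rewrite !(mulr_gt0, invr_gt0).
have lnr : ln (r / m0) = ln (u / u0) + ln (v / v0).
  rewrite -lnM ?posrE ?divr_gt0 //; congr ln.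
  by rewrite /r; field; rewrite u0n v0n gt_eqF.
have := mulr_ln_div_tangent _ _ r (ltW m_gt0) m0_gt0 r0; rewrite lnr.
(* The logarithms left over have coefficients [-(1 - v)] and [-(1 - u)], both nonpositive, so
   [ln t <= t - 1] gives a lower bound. *)
have y0 : 0 <= 1 - v by lra.
have x0 : 0 <= 1 - u by lra.
have hu := mul_ln_le (1 - v) u u0 y0 u_gt0 u0_gt0.
have hv := mul_ln_le (1 - u) v v0 x0 v_gt0 v0_gt0.
have : (u0 - u) * (v0 - v) / (u0 * v0) = - ((1 - v) * (u / u0 - 1))
   - (1 - u) * (v / v0 - 1) + (u + v - 1) - r.
  by rewrite /r /m0; field; rewrite u0n v0n.
by move: hu hv; lra.
Qed.

End LogBounds.

(** * Explicit form of the divergence of a feasible matrix *)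

Section Feasible.
Variable R : realType.

Lemma kl_mxE (T P : 'M[R]_2) : kl_mx T P =
  T 0 0 * ln (T 0 0 / P 0 0) + T 0 1 * ln (T 0 1 / P 0 1)
  + (T 1 0 * ln (T 1 0 / P 1 0) + T 1 1 * ln (T 1 1 / P 1 1)).
Proof.
rewrite /kl_mx /kl.
rewrite -(pair_big xpredT xpredT (fun i j => T i j * ln (T i j / P i j))) /=.
rewrite !big_ord_recl !big_ord0 !addr0.
by rewrite (_ : lift ord0 ord0 = 1); last exact/val_inj.
Qed.

Lemma bern_meanE (T : 'M[R]_2) :
  bern_mean T = col2 (T 0 0 + T 0 1) (T 0 0 + T 1 0).
Proof.
rewrite /bern_mean.
rewrite -(pair_big xpredT xpredT
  (fun i j => bern_pmf T (i, j) *: col2 (i : nat)%:R (j : nat)%:R)) /=.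
have r0 : rev_ord (ord0 : 'I_2) = 1 by apply/val_inj.
have r1 : rev_ord (lift ord0 ord0 : 'I_2) = 0 by apply/val_inj.
rewrite !big_ord_recl !big_ord0 !addr0 /bern_pmf /= !r0 !r1.
apply/matrixP => i j; rewrite !mxE /= (_ : bump 0 0 = 1%N) //.
by case: (i == 0) => /=; ring.
Qed.

Lemma col2_inj (a b a' b' : R) : col2 a b = col2 a' b' -> a = a' /\ b = b'.
Proof.
move=> /matrixP h; have := h 0 0; have := h 1 0.
by rewrite !mxE /= => -> ->.
Qed.

(** Absolute continuity forces [T 1 0 = 0]; the mean and the total mass then determine the other
    three entries. *)
Lemma kl_mx_feasible (p q w tq tu : R) (T : 'M[R]_2) :
  feasible (mx2 p q 0 w) tq tu T ->
  0 <= tq - tu /\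
  kl_mx T (mx2 p q 0 w) = tu * ln (tu / p) + (tq - tu) * ln ((tq - tu) / q)
    + (1 - tq) * ln ((1 - tq) / w).
Proof.
move=> [[T_ge0 T_sum] Tac]; rewrite bern_meanE => /col2_inj[tqE tuE].
have T10 : T 1 0 = 0 by apply: Tac; rewrite mxE.
move: T_sum; rewrite !big_ord_recl !big_ord0 !addr0.
rewrite (_ : lift ord0 ord0 = 1); last by apply/val_inj.
rewrite T10 => T_sum; rewrite T10 addr0 in tuE.
have T01 : T 0 1 = tq - tu by lra.
have T11 : T 1 1 = 1 - tq by move: T_sum; lra.
split; first by rewrite -T01.
by rewrite kl_mxE tuE T01 T10 T11 !mxE /= mul0r add0r.
Qed.

End Feasible.

(** * The scalar inequality in [s], [x], [y] *)

(* To be used with [a = x / s - 1] and [b = y / (10 s) - 1], after division by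
   [s^2]; the factor [20 = 2 * 10] includes the bound [2] on
   [1 / ((1 - s) (1 - 10 s))]. *)
Lemma absorb_product (R : realFieldType) (a b : R) : -1 <= a -> -1 <= b ->
  a * b <= 0 ->
  0 <= 20 * (a * b) + 200 * (b ^+ 2 / (2 * (b + 2)))
       + 120 * (a ^+ 2 / (2 * (a + 2))).
Proof.
move=> a1 b1 ab0.
(* The fraction is bounded quadratically up to [t = 1] and linearly beyond. *)
have neg (t : R) : -1 <= t -> t <= 0 -> t ^+ 2 / 4 <= t ^+ 2 / (2 * (t + 2)).
  by move=> t1 t0; rewrite ler_wpM2l ?sqr_ge0 // lef_pV2 ?posrE; lra.
have small (t : R) : 0 <= t -> t <= 1 -> t ^+ 2 / 6 <= t ^+ 2 / (2 * (t + 2)).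
  by move=> t0 t1; rewrite ler_wpM2l ?sqr_ge0 // lef_pV2 ?posrE; lra.
have large (t : R) : 1 <= t -> t / 6 <= t ^+ 2 / (2 * (t + 2)).
  by move=> t1; rewrite ler_pdivlMr; nra.
have [a0|a0] := leP 0 a.
  have [bp|bn] := ltP 0 b.
    have -> : a = 0 by nra.
    rewrite mul0r mulr0 add0r expr0n /= mul0r mulr0 addr0.
    by rewrite mulr_ge0 // divr_ge0 ?sqr_ge0 //; lra.
  have hb := neg b b1 bn; have [a1'|a1'] := leP a 1.
    have ha := small a a0 a1'; have := sqr_ge0 (a + b).
    by have := sqr_ge0 a; have := sqr_ge0 b; move: ha hb; nra.
  have ha := large a (ltW a1'); have := sqr_ge0 b.
  (* As [120 / 6 = 20], the product and the linear term combine to [20 a (1 + b)]. *)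
  have : 0 <= a * (1 + b) by rewrite mulr_ge0 //; lra.
  by move: ha hb; lra.
have b0 : 0 <= b by nra.
have ha := neg a a1 (ltW a0); have [b1'|b1'] := leP b 1.
  have hb := small b b0 b1'; have := sqr_ge0 (a + b).
  by have := sqr_ge0 a; have := sqr_ge0 b; move: ha hb; nra.
have hb := large b (ltW b1'); have := sqr_ge0 a.
have : 0 <= b * (1 + a) by rewrite mulr_ge0 //; lra.
by move: ha hb; lra.
Qed.

(** The claim multiplied by [kl_bern tu wu], with 120 as a lower bound for [alpha C0]. *)
Lemma objective_core (R : realType) (s x y : R) :
  0 < s -> 22 * s <= 1 -> 0 <= x -> 0 <= y -> x + y <= 1 ->
  0 <= x * ln (x / s) + y * ln (y / (10 * s))
       + (1 - x - y) * ln ((1 - x - y) / (1 - 11 * s))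
       - kl_bern x s - (1 - 20 * s) * kl_bern y (10 * s)
       + 120 * s * kl_bern x s.
Proof.
move=> s0 s22 x0 y0 xy1.
have [x01 s01] : 0 <= x <= 1 /\ 0 < s < 1 by split; lra.
have [y01 s10] : 0 <= y <= 1 /\ 0 < 10 * s < 1 by split; lra.
have hx := kl_bern_hellinger _ _ _ x01 s01.
have hy := kl_bern_hellinger _ _ _ y01 s10.
have := interaction_ge _ (1 - x) (1 - y) (1 - s) (1 - 10 * s).
rewrite (_ : 1 - x + (1 - y) - 1 = 1 - x - y); last by ring.
rewrite (_ : 1 - s + (1 - 10 * s) - 1 = 1 - 11 * s); last by ring.
rewrite (_ : 1 - s - (1 - x) = x - s); last by ring.
rewrite (_ : 1 - 10 * s - (1 - y) = y - 10 * s); last by ring.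
move=> inter.
have {}inter : (x - s) * (y - 10 * s) / ((1 - s) * (1 - 10 * s)) <=
    x * ln (x / s) + y * ln (y / (10 * s))
    + (1 - x - y) * ln ((1 - x - y) / (1 - 11 * s))
    - kl_bern x s - kl_bern y (10 * s).
  by apply: le_trans (inter _ _ _ _ _ _) _; rewrite /kl_bern; lra.
suff : 0 <= (x - s) * (y - 10 * s) / ((1 - s) * (1 - 10 * s))
    + 20 * (s * kl_bern y (10 * s)) + 120 * (s * kl_bern x s).
  by move: inter; lra.
have {}hx := ler_wpM2l (ltW s0) hx.
have {}hy := ler_wpM2l (ltW s0) hy.
have [pq0|pq0] := leP 0 ((x - s) * (y - 10 * s)).
  have h1 : 0 <= (x - s) * (y - 10 * s) / ((1 - s) * (1 - 10 * s)).
    by rewrite divr_ge0 // mulr_ge0; lra.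
  have h2 : 0 <= s * ((x - s) ^+ 2 / (2 * (x + s))).
    by rewrite mulr_ge0 ?divr_ge0 ?sqr_ge0 //; lra.
  have h3 : 0 <= s * ((y - 10 * s) ^+ 2 / (2 * (y + 10 * s))).
    by rewrite mulr_ge0 ?divr_ge0 ?sqr_ge0 //; lra.
  by move: hx hy h1 h2 h3; lra.
(* For [s <= 1/22] the denominator is at least [252/484 > 1/2]; the numerator is negative. *)
have inter2 : 2 * ((x - s) * (y - 10 * s)) <=
    (x - s) * (y - 10 * s) / ((1 - s) * (1 - 10 * s)).
  rewrite mulrC ler_wnM2l ?(ltW pq0) // invf_ple ?posrE //; nra.
pose a := x / s - 1; pose b := y / (10 * s) - 1.
have sn : s != 0 by rewrite gt_eqF.
have xE : x = s * (a + 1) by rewrite /a; field.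
have yE : y = 10 * s * (b + 1) by rewrite /b; field.
have a1 : -1 <= a by rewrite /a lerBrDr addNr divr_ge0 // ltW.
have b1 : -1 <= b by rewrite /b lerBrDr addNr divr_ge0 //; lra.
have a2 : a + 2 != 0 by rewrite gt_eqF //; lra.
have b2 : b + 2 != 0 by rewrite gt_eqF //; lra.
(* All three terms scale as [s^2], with coefficients [2 * 10], [20 * 10] and 120. *)
have pqE : (x - s) * (y - 10 * s) = 10 * s ^+ 2 * (a * b).
  by rewrite xE yE; ring.
have xgE : s * ((x - s) ^+ 2 / (2 * (x + s))) =
    s ^+ 2 * (a ^+ 2 / (2 * (a + 2))).
  rewrite (_ : x + s = s * (a + 2)); last by rewrite xE; ring.
  by rewrite xE; field; rewrite sn a2.
have ygE : s * ((y - 10 * s) ^+ 2 / (2 * (y + 10 * s))) =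
    10 * s ^+ 2 * (b ^+ 2 / (2 * (b + 2))).
  rewrite (_ : y + 10 * s = 10 * s * (b + 2)); last by rewrite yE; ring.
  by rewrite yE; field; rewrite sn b2.
have s2 : 0 < s ^+ 2 by rewrite exprn_gt0.
have ab0 : a * b <= 0.
  by move: pq0; rewrite pqE pmulr_rlt0 ?mulr_gt0 // => /ltW.
have := mulr_ge0 (ltW s2) (absorb_product _ _ _ a1 b1 ab0).
move: hx hy inter2; rewrite xgE ygE pqE.
set ga := a ^+ 2 / _; set gb := b ^+ 2 / _; lra.
Qed.

Theorem theorem6p10 (R : realType) :
  exists C0 : R, 0 < C0 /\
  forall c : R, 500%:R <= c ->
  let wq := 1 - 10%:R / Num.sqrt c in
  let wu := 1 / Num.sqrt c in
  let alpha := 1 - 20%:R / Num.sqrt c in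
  let P := mx2 wu (wq - wu) 0 (1 - wq) in
  ((alpha * (1 - C0 / Num.sqrt c))%:E
     <= ereal_inf (objective_values P wq wu alpha))%E.
Proof.
(* 1320 = 11 * 120, since alpha >= 1/11 *)
exists 1320; split; first by lra.
move=> c c500.
pose wq := 1 - 10%:R / Num.sqrt c; pose wu := 1 / Num.sqrt c.
pose alpha := 1 - 20%:R / Num.sqrt c.
pose P := mx2 wu (wq - wu) 0 (1 - wq).
change ((alpha * (1 - 1320 / Num.sqrt c))%:E
  <= ereal_inf (objective_values P wq wu alpha))%E.
(* Here [22^2 = 484 <= 500]. *)
have sc : 22 <= Num.sqrt c.
  have h22 : (0 : R) <= 22 by lra.
  rewrite -(ger0_norm h22) -sqrtr_sqr ler_wsqrtr //.
  by apply: le_trans c500; lra.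
have sc0 : 0 < Num.sqrt c by lra.
have wu0 : 0 < wu by rewrite divr_gt0.
have wu22 : 22 * wu <= 1 by rewrite mulrA mulr1 ler_pdivrMr ?mul1r.
have wqE : wq = 1 - 10 * wu by rewrite /wq /wu mulrA mulr1.
have alphaE : alpha = 1 - 20 * wu by rewrite /alpha /wu mulrA mulr1.
apply: le_ereal_inf_tmp => _ [tq [tu [T [tq01 tu01 tuw [Tf _] ->]]]].
case/andP: tq01 tu01 => tq0 tq1 /andP[tu0 tu1].
rewrite lee_fin (_ : 1320 / Num.sqrt c = 1320 * wu); last first.
  by rewrite /wu mulrA mulr1.
have [tqu klE] := kl_mx_feasible _ _ _ _ _ _ _ Tf.
(* Strict positivity, from [tu <> wu], lets the common denominator be cleared. *)
have Du0 : 0 < kl_bern tu wu.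
  have: (tu - wu) ^+ 2 / (2 * (tu + wu)) <= kl_bern tu wu.
    by apply: kl_bern_hellinger; lra.
  apply: lt_le_trans; apply: divr_gt0; last lra.
  by rewrite exprn_even_gt0 //= subr_eq0; apply/eqP.
have y0 : 0 <= 1 - tq by lra.
have xy1 : tu + (1 - tq) <= 1 by lra.
have := objective_core _ wu tu (1 - tq) wu0 wu22 tu0 y0 xy1.
rewrite -(kl_bernC _ (1 - tq)) subKr -wqE -alphaE.
rewrite (_ : 1 - tu - (1 - tq) = tq - tu); last by ring.
rewrite (_ : 1 - 11 * wu = wq - wu); last by rewrite wqE; ring.
rewrite (_ : 10 * wu = 1 - wq); last by rewrite wqE; ring.
(* The weights sum to 1, so the numerator is [D - alpha Dq - (1 - alpha) Du]; subtracting [alpha Du]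
   completes the full [Du] of [core]. *)
move=> core; rewrite /objective [alpha * (_ / _)]mulrA.
rewrite [(1 - alpha) * (_ / _)]mulrA -mulrDl ler_pdivlMr //.
rewrite [kl_mx _ _]klE.
have alpha_ge : 0 <= alpha * 1320 - 120 by rewrite alphaE; lra.
have := mulr_ge0 alpha_ge (mulr_ge0 (ltW wu0) (ltW Du0)).
by move: core; clearbody wu wq alpha; lra.
Qed.
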